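(* Let $X$ and $Y$ be finite non-empty sets. Then \[ m_{\rm map}(X:Y)=\lceil |X|/|Y|\rceil . \]
   Context: For a map $f:X\to Y$ of non-empty sets, $m_{\rm map}(f)=\sup\{|f^{-1}(y)|\mid y\in Y\}\in\mathbb{N}\cup\{\infty\}$, and $m_{\rm map}(X:Y)$ is the infimum of $m_{\rm map}(f)$ over all maps $f:X\to Y$. For a real number $a$, $\lceil a\rceil$ is the least integer no less than $a$. *)

(* Defs.v *)
From mathcomp Require Import all_boot all_order all_algebra.
From mathcomp Require Import all_classical all_reals all_analysis.

Set Implicit Arguments.
Unset Strict Implicit.
Unset Printing Implicit Defensive.

Local Open Scope classical_set_scope.
Local Open Scope ring_scope.

(* The values in N u {oo} live in the extended reals: [counting A] is the
   cardinal of A, and +oo if A is infinite. For non-empty X and Y, the supremum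
   and infimum below range over non-empty subsets of N u {oo}, so they agree
   with those taken in N u {oo}. (The -oo of [ereal_sup set0] only shows up when
   Y is empty.) *)
Definition m_map (R : realType) (X : choiceType) (Y : Type) (f : X -> Y)
    : \bar R :=
  ereal_sup [set counting (f @^-1` [set y]) | y in [set: Y]].

Definition m_map_inf (R : realType) (X : choiceType) (Y : Type) : \bar R :=
  ereal_inf [set m_map R f | f in [set: X -> Y]].

(* Main.v *)
Require Import Defs.
From mathcomp Require Import all_boot all_order all_algebra.
From mathcomp Require Import all_classical all_reals all_analysis.

(** The ceiling of [|X| / |Y|] is the least natural number [n] with
    [|X| <= n |Y|], so it suffices to see that this inequality holds exactly
    when some map [X -> Y] has all its fibres of cardinality at most [n].

    If the fibres of [f] have at most [n] elements, then summing over the fibres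
    gives [|X| <= n |Y|] ([card_le_fibers]).  Conversely, if [|X| <= n |Y|],
    then [X] embeds into [Y * 'I_n], and the first component of the embedding
    is the required map, because the second component embeds each of its fibres
    into ['I_n] ([exists_small_fibers]).

    Infima and suprema cause no trouble: for finite sets every fibre has a
    natural number as cardinality, and the supremum over the non-empty finite
    set [Y] is attained. *)

Import Order.TTheory GRing.Theory Num.Theory.

Set Implicit Arguments.
Unset Strict Implicit.
Unset Printing Implicit Defensive.

Lemma counting_finType (R : realType) (X : finType) (P : pred X) :
  counting [set x | P x]%classic = (#|P|%:R%:E : \bar R).
Proof.
rewrite /counting asboolT; last exact: finite_finset.
congr (_%:R%:E); rewrite -(card_uniqP (finmap.fset_uniq _)).
apply: eq_card => x.
rewrite in_fset_set; last exact: finite_finset.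
by apply/idP/idP => [/set_mem|Px] //; apply/mem_set.
Qed.

Lemma m_map_finType (R : realType) (X Y : finType) (f : X -> Y) :
  m_map R f =
  ereal_sup [set #|[pred x | f x == y]|%:R%:E | y in [set: Y]]%classic.
Proof.
congr ereal_sup; apply: eq_imagel => y _.
rewrite -counting_finType; congr counting.
by apply/seteqP; split=> x /= /eqP.
Qed.

Lemma card_le_fibers (X Y : finType) (f : X -> Y) (n : nat) :
  (forall y, #|[pred x | f x == y]| <= n)%N -> (#|X| <= n * #|Y|)%N.
Proof.
move=> fn; rewrite -sum1_card (partition_big f predT) //= mulnC -sum_nat_const.
rewrite [leqRHS](eq_bigl predT) //; apply: leq_sum => y _.
by rewrite (leq_trans _ (fn y)) // -sum1_card; apply/eq_leq/eq_bigl.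
Qed.

Lemma exists_injection (X Z : finType) :
  (#|X| <= #|Z|)%N -> exists g : X -> Z, injective g.
Proof.
move=> XZ; exists (fun x => enum_val (widen_ord XZ (enum_rank x))).
by move=> x y /enum_val_inj/(congr1 val)/= /val_inj/enum_rank_inj.
Qed.

Lemma exists_small_fibers (X Y : finType) (n : nat) :
  (#|X| <= n * #|Y|)%N ->
  exists f : X -> Y, forall y, (#|[pred x | f x == y]| <= n)%N.
Proof.
move=> XnY.
have [|g g_inj] := @exists_injection X (Y * 'I_n)%type.
  by rewrite card_prod card_ord mulnC.
exists (fun x => (g x).1) => y; rewrite -[leqRHS]card_ord.
apply: (@leq_card_in _ _ (fun x => (g x).2)) => x x'.
rewrite !inE => /eqP gx /eqP gx' gxx'; apply: g_inj.
by rewrite [g x]surjective_pairing [g x']surjective_pairing gx gx' gxx'.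
Qed.

(** This turns every comparison with the ceiling into an inequality between
    natural numbers, in the form that the two lemmas on fibres use. *)
Lemma ceil_divn_le (R : realType) (a b n : nat) : (0 < b)%N ->
  (Num.ceil (a%:R / b%:R : R) <= n%:Z)%R = (a <= n * b)%N.
Proof.
by move=> b0; rewrite ceil_le_int ler_pdivrMr ?ltr0n // -natrM ler_nat.
Qed.

Theorem proposition1p5 (R : realType) (X Y : finType)
    (hX : (0 < #|X|)%N) (hY : (0 < #|Y|)%N) :
  m_map_inf R X Y = ((Num.ceil (#|X|%:R / #|Y|%:R : R))%:~R)%:E%R.
Proof.
have : (0 <= Num.ceil (#|X|%:R / #|Y|%:R : R))%R.
  by rewrite ceil_ge0 (lt_le_trans (ltrN10 R)) // divr_ge0.
case: (Num.ceil _) (fun n => @ceil_divn_le R #|X| #|Y| n hY) => // m mP _.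
apply/eqP; rewrite eq_le; apply/andP; split.
- have [f fm] : exists f : X -> Y, forall y, (#|[pred x | f x == y]| <= m)%N.
    by apply: exists_small_fibers; rewrite -mP.
  apply: (@le_trans _ _ (m_map R f)); first by apply: ereal_inf_lbound; exists f.
  rewrite m_map_finType; apply: ge_ereal_sup => _ [y _ <-].
  by rewrite lee_fin ler_nat.
- apply: le_ereal_inf_tmp => _ [f _ <-]; rewrite m_map_finType.
  (* The supremum is bounded below by the size of a largest fibre, which exists
     because [Y] is finite and non-empty. *)
  have [y0 _] := card_gt0P hY.
  case: (@arg_maxnP _ y0 predT (fun y => #|[pred x | f x == y]|)) => // y _ ymax.
  apply: (@le_trans _ _ (#|[pred x | f x == y]|%:R%:E)%R).
    rewrite lee_fin ler_nat -lez_nat mP.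
    by apply: card_le_fibers => z; exact: ymax.
  by apply: ereal_sup_ubound; exists y.
Qed.
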